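(* Let $T_{(\cdot)}\colon\mathcal{H}^d\to\mathcal{H}^d$ be a frugal splitting operator over $\mathcal{A}_n^F$ with representation $(p,M,N,U,V)$ such that $M$ is a $p$-kernel over $\mathcal{A}_n^F$, $\ker\begin{bmatrix}N&-M\end{bmatrix}\supseteq\ker\begin{bmatrix}U&-V\end{bmatrix}$ and $\operatorname{ran}U\supseteq\operatorname{ran}V$. If $z^\star\in\operatorname{fix}T_A$ for some $A=(A_1,\dots,A_n)\in\mathcal{A}_n^F$, then the tuple $(y_1^\star,\dots,y_n^\star):=(M+\Phi_{A,p})^{-1}Nz^\star$ satisfies $$(y_1^\star,\dots,y_n^\star)\in\operatorname{zer}\Phi_{A,p}\quad\text{and}\quad y_p^\star\in\operatorname{zer}\sum_{i=1}^nA_i.$$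
   Context: Throughout, $\mathcal{H}$ is a real Hilbert space with $\dim\mathcal{H}\ge 2$, $n,d\in\mathbb{N}_+=\{1,2,\dots\}$ and $F\subset\{1,\dots,n\}$ is a strict subset. A set-valued operator $A\colon\mathcal{H}\to2^{\mathcal{H}}$ is called single-valued if $Ax$ is a singleton for every $x\in\mathcal{H}$, and is then identified with a map. $J_A=(\mathrm{Id}+A)^{-1}$ is the resolvent, $\operatorname{zer}A=\{x: 0\in Ax\}$, $\operatorname{fix}T=\{z:Tz=z\}$. Operator tuples: $\mathcal{A}_n^F$ is the set of tuples $A=(A_1,\dots,A_n)$ where every $A_i\colon\mathcal{H}\to2^{\mathcal{H}}$ is maximally monotone and $A_i$ is single-valued for all $i\in F$. Parameterized operators: $T_{(\cdot)}\colon X\to Y$ parameterized by $\mathcal{A}_n^F$ means a map $T_A\colon X\to Y$ for each $A\in\mathcal{A}_n^F$. Matrices as operators: a matrix $B\in\mathbb{R}^{k\times m}$ acts on $z=(z_1,\dots,z_m)\in\mathcal{H}^m$ by $(Bz)_i=\sum_{j=1}^m B_{ij}z_j$, giving $Bz\in\mathcal{H}^k$. Primal-dual operator: for $A\in\mathcal{A}_n^F$ and $p\in\{1,\dots,n\}$, $\Phi_{A,p}=\Delta_{A,p}+\Gamma_p\colon\mathcal{H}^n\to2^{\mathcal{H}^n}$, where $\Delta_{A,p}(y_1,\dots,y_n)=\widehat{A}_1y_1\times\dots\times\widehat{A}_ny_n$ with $\widehat{A}_p=A_p$ and $\widehat{A}_i=A_i^{-1}$ for $i\ne p$, and $\Gamma_p=R_p-R_p^T\in\mathbb{R}^{n\times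 n}$, where $R_p$ has ones on the $p$th row and zeros elsewhere. Frugal splitting operator: $T_{(\cdot)}\colon\mathcal{H}^d\to\mathcal{H}^d$ parameterized by $\mathcal{A}_n^F$ is a frugal splitting operator over $\mathcal{A}_n^F$ if there exist $d_1,\dots,d_{n+1}\in\mathbb{N}_+$ with $d_1=d_{n+1}=d$ and, for each $i\in\{1,\dots,n\}$, an operator $\tau_{i,(\cdot)}\colon\mathcal{H}^{d_i}\to\mathcal{H}^{d_{i+1}}$ parameterized by $\mathcal{A}_n^F$ such that, for all $A\in\mathcal{A}_n^F$: (1) $\operatorname{fix}T_A\neq\emptyset\iff\operatorname{zer}\sum_{i=1}^nA_i\ne\emptyset$; (2) $T_A=\tau_{n,A}\circ\tau_{n-1,A}\circ\cdots\circ\tau_{1,A}$; and moreover for each $i$ there exist $B_i\in\mathbb{R}^{d_{i+1}\times d_i}$, $C_i\in\mathbb{R}^{d_{i+1}\times1}$, $D_i\in\mathbb{R}^{1\times d_i}$, $\gamma_i>0$ (independent of $A$) such that for all $A\in\mathcal{A}_n^F$ and $z_i\in\mathcal{H}^{d_i}$, $\tau_{i,A}z_i=B_iz_i+C_iJ_{\gamma_iA_i}(D_iz_i)$ if $i\notin F$ and $\tau_{i,A}z_i=B_iz_i+C_iA_i(D_iz_i)$ if $i\in F$. Representation: $T_{(\cdot)}\colon\mathcal{H}^d\to\mathcal{H}^d$ parameterized by $\mathcal{A}_n^F$ is a generalized primal-dual resolvent with representation $(p,M,N,U,V)$, where $p\in\{1,\dots,n\}$, $M\in\mathbb{R}^{n\times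 n}$, $N\in\mathbb{R}^{n\times d}$, $U\in\mathbb{R}^{d\times d}$, $V\in\mathbb{R}^{d\times n}$, if for all $A\in\mathcal{A}_n^F$ and all $z\in\mathcal{H}^d$, $(M+\Phi_{A,p})^{-1}\circ N$ is single-valued at $z$ and, with $y=(M+\Phi_{A,p})^{-1}Nz\in\mathcal{H}^n$, $T_Az=z-Uz+Vy$. $p$-kernel: $M\in\mathbb{R}^{n\times n}$ is a $p$-kernel over $\mathcal{A}_n^F$ if $p\notin F$, $M+\Gamma_p$ is lower triangular, $M_{i,i}\ge0$ for all $i\in\{1,\dots,n\}$, and $M_{i,i}=0$ if and only if $i\in F$. *)

(* Defs.v *)
From HB Require Import structures.
From mathcomp Require Import all_boot all_order all_algebra.
From mathcomp Require Import all_classical all_reals all_analysis.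

Set Implicit Arguments.
Unset Strict Implicit.
Unset Printing Implicit Defensive.

Import Order.TTheory GRing.Theory Num.Theory.
Import numFieldNormedType.Exports.

Local Open Scope classical_set_scope.
Local Open Scope ring_scope.

(* Real Hilbert spaces: complete normed spaces whose norm is induced by a
   symmetric, positive definite bilinear form ({dot _ for idfun}). *)
HB.mixin Record CompleteNormedModule_isHilbert (R : realType) H
    of CompleteNormedModule R H := {
  inner : {dot H for (@idfun R)};
  normE_inner : forall x : H, `|x| ^+ 2 = inner x x
}.

#[short(type="hilbertType")]
HB.structure Definition Hilbert (R : realType) :=
  {H of CompleteNormedModule R H & CompleteNormedModule_isHilbert R H}.

Definition dim_ge2 (R : realType) (H : hilbertType R) : Prop :=
  exists x y : H, forall a b : R, a *: x + b *: y = 0 -> a = 0 /\ b = 0.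

(* A set-valued operator X -> 2^Y is a map X -> set Y. *)

Definition op_inv (X Y : Type) (A : X -> set Y) : Y -> set X :=
  fun u => [set x | A x u].

Definition op_of (X Y : Type) (f : X -> Y) : X -> set Y := fun x => [set f x].

Definition op_add (X : Type) (Y : zmodType) (A B : X -> set Y) : X -> set Y :=
  fun x => [set u + v | u in A x & v in B x].

Definition op_sum (n : nat) (X : Type) (Y : zmodType)
    (A : 'I_n -> X -> set Y) : X -> set Y :=
  fun x => [set \sum_i u i | u in [set u : 'I_n -> Y | forall i, A i x (u i)]].

Definition op_scale (R : realType) (X : Type) (Y : lmodType R) (g : R)
    (A : X -> set Y) : X -> set Y :=
  fun x => [set g *: u | u in A x].

Definition zer (X : Type) (Y : zmodType) (A : X -> set Y) : set X :=
  [set x | A x 0].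

Definition fix_set (X : Type) (T : X -> X) : set X := [set z | T z = z].

Definition single_valued_at (X Y : Type) (A : X -> set Y) (x : X) : Prop :=
  exists u, A x = [set u].

Definition single_valued (X Y : Type) (A : X -> set Y) : Prop :=
  forall x, single_valued_at A x.

(* The map identified with A: its value at x is the unique element of A x
   wherever A is single-valued at x (and is irrelevant elsewhere). *)
Definition op_map (X : Type) (Y : pointedType) (A : X -> set Y) : X -> Y :=
  fun x => get (A x).

Definition resolvent (X : zmodType) (A : X -> set X) : X -> set X :=
  op_inv (op_add (op_of id) A).

Definition monotone_op (R : realType) (H : hilbertType R) (A : H -> set H) :=
  forall x y u v : H, A x u -> A y v -> 0 <= inner (x - y) (u - v).

Definition maximally_monotone (R : realType) (H : hilbertType R)
    (A : H -> set H) : Prop :=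
  monotone_op A /\
  forall B : H -> set H, monotone_op B ->
    (forall x, A x `<=` B x) -> forall x, B x = A x.

Record op_tuple (R : realType) (H : hilbertType R) (n : nat) (F : {set 'I_n}) :=
  OpTuple {
    ops :> 'I_n -> H -> set H;
    ops_maximal : forall i, maximally_monotone (ops i);
    ops_single : forall i, i \in F -> single_valued (ops i)
  }.
Arguments op_tuple {R} H {n} F.

(* H^m is represented by 'I_m -> H; a real k x m matrix acts from H^m to H^k. *)
Definition mxact (R : realType) (H : lmodType R) (k m : nat)
    (B : 'M[R]_(k, m)) (z : 'I_m -> H) : 'I_k -> H :=
  fun i => \sum_j B i j *: z j.

Definition mxker (R : realType) (k m : nat) (B : 'M[R]_(k, m)) :
    set 'cV[R]_m :=
  [set w | B *m w = 0].

Definition mxran (R : realType) (k m : nat) (B : 'M[R]_(k, m)) :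
    set 'cV[R]_k :=
  range (fun w : 'cV[R]_m => B *m w).

Definition row_ones (R : realType) (n : nat) (p : 'I_n) : 'M[R]_n :=
  \matrix_(i, j) (i == p)%:R.

Definition Gamma (R : realType) (n : nat) (p : 'I_n) : 'M[R]_n :=
  row_ones R p - (row_ones R p)^T.

Definition Delta (R : realType) (H : hilbertType R) (n : nat)
    (A : 'I_n -> H -> set H) (p : 'I_n) : ('I_n -> H) -> set ('I_n -> H) :=
  fun y => [set v | forall i,
    (if i == p then A i else op_inv (A i)) (y i) (v i)].

Definition Phi (R : realType) (H : hilbertType R) (n : nat)
    (A : 'I_n -> H -> set H) (p : 'I_n) : ('I_n -> H) -> set ('I_n -> H) :=
  op_add (Delta A p) (op_of (mxact (Gamma R p))).

Definition pd_resolvent (R : realType) (H : hilbertType R) (n : nat)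
    (A : 'I_n -> H -> set H) (p : 'I_n) (M : 'M[R]_n) :
    ('I_n -> H) -> set ('I_n -> H) :=
  op_inv (op_add (op_of (mxact M)) (Phi A p)).

(* tau (k-1) \o ... \o tau 0 *)
Fixpoint comp_steps (X : nat -> Type) (tau : forall i, X i -> X i.+1)
    (k : nat) : X 0%N -> X k :=
  if k is k'.+1 then fun z => tau k' (comp_steps tau k' z) else id.

(* Indices are shifted to start at 0: dims i is the dimension d_(i+1) and
   tau A i is tau_(i+1,A).  Only dims 0, ..., dims n and tau A 0, ...,
   tau A (n-1) matter.  Precomposition with cast_ord identifies H^d with
   H^(dims 0) and H^(dims n). *)
Definition frugal_splitting (R : realType) (H : hilbertType R) (n d : nat)
    (F : {set 'I_n}) (T : op_tuple H F -> ('I_d -> H) -> ('I_d -> H)) : Prop :=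
  exists (dims : nat -> nat) (d_first : dims 0%N = d) (d_last : dims n = d)
    (tau : op_tuple H F ->
       forall i : nat, ('I_(dims i) -> H) -> ('I_(dims i.+1) -> H)),
  [/\ forall i, (i <= n)%N -> (0 < dims i)%N,
      forall A : op_tuple H F,
        fix_set (T A) !=set0 <-> zer (op_sum A) !=set0,
      forall (A : op_tuple H F) (z : 'I_d -> H),
        T A z \o cast_ord d_last =
        @comp_steps (fun i => 'I_(dims i) -> H) (tau A) n (z \o cast_ord d_first)
    & forall i : 'I_n,
        exists (B : 'M[R]_(dims i.+1, dims i)) (C : 'M[R]_(dims i.+1, 1))
          (D : 'M[R]_(1, dims i)) (g : R),
        0 < g /\
        forall (A : op_tuple H F) (z : 'I_(dims i) -> H),
          let x := mxact D z ord0 in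
          tau A i z = mxact B z + mxact C (fun=>
            if i \in F then op_map (A i) x
            else op_map (resolvent (op_scale g (A i))) x)].

Definition has_representation (R : realType) (H : hilbertType R) (n d : nat)
    (F : {set 'I_n}) (T : op_tuple H F -> ('I_d -> H) -> ('I_d -> H))
    (p : 'I_n) (M : 'M[R]_n) (N : 'M[R]_(n, d)) (U : 'M[R]_d)
    (V : 'M[R]_(d, n)) : Prop :=
  forall (A : op_tuple H F) (z : 'I_d -> H),
    single_valued_at (pd_resolvent A p M) (mxact N z) /\
    let y := op_map (pd_resolvent A p M) (mxact N z) in
    T A z = z - mxact U z + mxact V y.

(* is_trig_mx is lower triangularity. *)
Definition is_pkernel (R : realType) (n : nat) (F : {set 'I_n}) (p : 'I_n)
    (M : 'M[R]_n) : Prop :=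
  [/\ p \notin F,
      is_trig_mx (M + Gamma R p),
      forall i, 0 <= M i i
    & forall i, M i i = 0 <-> i \in F].

(* Main.v *)
Require Import Defs.
From HB Require Import structures.
From mathcomp Require Import all_boot all_order all_algebra.
From mathcomp Require Import all_classical all_reals all_analysis.

Set Implicit Arguments.
Unset Strict Implicit.
Unset Printing Implicit Defensive.

Import Order.TTheory GRing.Theory Num.Theory.
Import numFieldNormedType.Exports.

Local Open Scope classical_set_scope.
Local Open Scope ring_scope.

(** At a fixed point [z] of [T A], the representation says [U z = V y], where
    [y] is the point of [pd_resolvent A p M] at [N z]. The kernel inclusion
    turns this linear relation into [N z = M y]: by [mxker_sub_factor] it
    provides a real matrix [L] with [N = L U] and [M = L V], so the relation
    transfers from real vectors to tuples of vectors of the Hilbert space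
    ([mxact_ker_sub]). The resolvent inclusion [N z] in [M y + Phi y] then loses
    its linear part and leaves [0] in [Phi y].

    The rest is the duality built into [Phi] ([zer_Phi_primal]): a zero of
    [Phi A p] consists of a primal solution, at coordinate [p], and of elements
    of the other operators at that point, which certify it. *)

Section MatrixAction.
Variables (R : realType) (H : lmodType R).

Lemma mxact_mul (k l m : nat) (B : 'M[R]_(k, l)) (C : 'M[R]_(l, m))
    (z : 'I_m -> H) : mxact (B *m C) z = mxact B (mxact C z).
Proof.
apply/funext => i; rewrite /mxact.
under eq_bigr => j _ do rewrite mxE scaler_suml.
rewrite exchange_big; apply: eq_bigr => l0 _.
by rewrite scaler_sumr; apply: eq_bigr => j _; rewrite scalerA.
Qed.

(** The columns of [cokermx B] span the kernel of [B], so a matrix vanishing on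
    that kernel annihilates [cokermx B], which is the criterion for its rows to
    lie in the row space of [B]. *)
Lemma mxker_sub_factor (k l m : nat) (B : 'M[R]_(k, m)) (C : 'M[R]_(l, m)) :
  mxker B `<=` mxker C -> exists L : 'M[R]_(l, k), C = L *m B.
Proof.
move=> kerBC; apply/submxP; rewrite submxE; apply/eqP/matrixP => i j.
have /kerBC : mxker B (col j (cokermx B)).
  by rewrite /mxker /= colE mulmxA mulmx_coker mul0mx.
rewrite /mxker /= colE mulmxA -colE => /matrixP /(_ i 0).
by rewrite !mxE.
Qed.

(** The kernels are those of the real matrices, whereas [z] and [y] have entries
    in [H]; a factorization through a real matrix bridges the two. *)
Lemma mxact_ker_sub (k l d n : nat) (U : 'M[R]_(k, d)) (V : 'M[R]_(k, n))
    (N : 'M[R]_(l, d)) (M : 'M[R]_(l, n)) (z : 'I_d -> H) (y : 'I_n -> H) :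
  mxker (row_mx U (- V)) `<=` mxker (row_mx N (- M)) ->
  mxact U z = mxact V y -> mxact N z = mxact M y.
Proof.
move=> /mxker_sub_factor [L]; rewrite mul_mx_row => /eq_row_mx [-> +] UzVy.
by rewrite mulmxN => /oppr_inj ->; rewrite !mxact_mul UzVy.
Qed.

Lemma mxact_Gamma (n : nat) (p : 'I_n) (y : 'I_n -> H) (i : 'I_n) :
  mxact (Gamma R p) y i = (if i == p then \sum_j y j else 0) - y p.
Proof.
rewrite /mxact.
under eq_bigr => j _ do rewrite !mxE scalerBl.
rewrite big_split sumrN /=; congr (_ - _).
  case: (i == p); first by apply: eq_bigr => j _; rewrite scale1r.
  by rewrite big1 // => j _; rewrite scale0r.
rewrite (bigD1 p) //= eqxx scale1r big1 ?addr0 // => j /negbTE ->.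
by rewrite scale0r.
Qed.

End MatrixAction.

Section PrimalDual.
Variables (R : realType) (H : hilbertType R) (n : nat).
Variables (A : 'I_n -> H -> set H) (p : 'I_n).

(** Row [i] of [Gamma] is the sum of all coordinates (only for [i = p]) minus
    the [p]th one. So at a zero, [y p] is one of the values of the inverse of
    [A i] at [y i] for [i != p], and the sum of these [y i] cancels the element
    of [A p (y p)] in the [p]th coordinate. *)
Lemma zer_Phi_primal (y : 'I_n -> H) : zer (Phi A p) y -> zer (op_sum A) (y p).
Proof.
case=> v Dv [_ ->] v_Gamma.
have vE i : v i = y p - (if i == p then \sum_j y j else 0).
  apply/eqP; rewrite -opprB -mxact_Gamma -addr_eq0.
  by rewrite -[_ + _]/((v + mxact _ y) i) v_Gamma.
exists (fun i => if i == p then v p else y i).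
  move=> i /=; have := Dv i; case: eqVneq => [->|ip] //.
  by rewrite /op_inv /= vE (negbTE ip) subr0.
rewrite (bigD1 p) //= eqxx vE eqxx.
rewrite (eq_bigr y) => [|i /negbTE -> //].
by rewrite (bigD1 p) //= opprD addrA subrr add0r addNr.
Qed.

Lemma pd_resolvent_zer (M : 'M[R]_n) (y : 'I_n -> H) :
  pd_resolvent A p M (mxact M y) y -> zer (Phi A p) y.
Proof.
case=> _ -> [w Phiw My_w]; rewrite /zer /=.
by have -> : 0 = w by apply: (addrI (mxact M y)); rewrite addr0 My_w.
Qed.

End PrimalDual.

Theorem proposition5p3 (R : realType) (H : hilbertType R) (hdim : dim_ge2 H)
    (n d : nat) (hn : (0 < n)%N) (hd : (0 < d)%N)
    (F : {set 'I_n}) (hF : F \proper [set: 'I_n]%SET)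
    (T : op_tuple H F -> ('I_d -> H) -> ('I_d -> H))
    (p : 'I_n) (M : 'M[R]_n) (N : 'M[R]_(n, d)) (U : 'M[R]_d)
    (V : 'M[R]_(d, n))
    (hT : frugal_splitting T)
    (hrep : has_representation T p M N U V)
    (hM : is_pkernel F p M)
    (hker : mxker (row_mx U (- V)) `<=` mxker (row_mx N (- M)))
    (hran : mxran V `<=` mxran U)
    (A : op_tuple H F) (zstar : 'I_d -> H) (hz : fix_set (T A) zstar) :
  let ystar := op_map (pd_resolvent A p M) (mxact N zstar) in
  zer (Phi A p) ystar /\ zer (op_sum A) (ystar p).
Proof.
move=> ystar; have [[u resE] TE] := hrep A zstar.
have resy : pd_resolvent A p M (mxact N zstar) ystar.
  by apply: getPex; exists u; rewrite resE.
have UzVy : mxact U zstar = mxact V ystar.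
  move: hz; rewrite /fix_set /= TE -addrA -[RHS]addr0 => /addrI /eqP.
  by rewrite addrC subr_eq0 eq_sym => /eqP.
have zPhi : zer (Phi A p) ystar.
  by apply: (@pd_resolvent_zer _ _ _ _ _ M); rewrite -(mxact_ker_sub hker UzVy).
by split=> //; apply: zer_Phi_primal.
Qed.
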